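(* Let $(\mathcal C,M)$ be a marked 2-category, $c$ an object of $\mathcal C$, and let $f_a\colon a\to c$ be a choice of a marked 1-cell for every object $a$ of $\mathcal C$ such that $f_c=1_c$. Then the following statements are equivalent: (i) $c$ is $M$-final; (ii) $c$ is $M$-bifinal with an $M$-contraction $\gamma$ (with center $c$) such that $\gamma_a=f_a$ for every object $a$; (iii) the inclusion $\{c\}\hookrightarrow(\mathcal C,M)$ is final.
   Context: Conventions. 2-categories and 2-functors are strict. Composition of 1-cells and whiskering are written by juxtaposition; $\beta\circ\alpha$ is vertical composition of 2-cells (first $\alpha$, then $\beta$). $\mathcal C(x,y)$ is the hom-category. A marked 2-category $(\mathcal C,M)$ is a 2-category with a class $M$ of 1-cells (the marked 1-cells, or marked edges) containing all identities; a marked 2-functor preserves marked 1-cells. $M$-final object. An object $c$ of $(\mathcal C,M)$ is $M$-final if: (1) for every object $a$ the category $\mathcal C(a,c)$ has a terminal object; (2) $1_c$ is terminal in $\mathcal C(c,c)$; (3) for every object $a$ there exists a marked 1-cell $a\to c$; (4) for every marked 1-cell $f\colon a\to b$, the precomposition functor $f^*\colon\mathcal C(b,c)\to\mathcal C(a,c)$ preserves terminal objects. Contractions. A contraction on $\mathcal C$ with center $c$ consists of 1-cells $\gamma_x\colon x\to c$ for all objects $x$ and 2-cells $\gamma_f\colon\gamma_y f\to\gamma_x$ for all 1-cells $f\colon x\to y$, such that $\gamma_{1_x}=1_{\gamma_x}$; $\gamma_{gf}=\gamma_f\circ(\gamma_g f)$; $\gamma_f=\gamma_g\circ(\gamma_y\alpha)$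 for every 2-cell $\alpha\colon f\to g\colon x\to y$; $\gamma_c=1_c$; and $\gamma_{\gamma_x}=1_{\gamma_x}$ for all $x$. An $M$-contraction is a contraction with every $\gamma_x$ in $M$ and $\gamma_f$ invertible for every $f\in M$. The object $c$ is $M$-bifinal if there is an $M$-contraction with center $c$. Final 2-functors. For a marked 2-category $(\mathcal D,M)$, a 2-functor $G\colon\mathcal D\to\mathcal E$ and an object $d$ of $\mathcal E$, let $\mathrm{Cocone}_M(G,d)$ be the category whose objects $\rho$ consist of 1-cells $\rho_x\colon Gx\to d$ and 2-cells $\rho_f\colon\rho_y G(f)\to\rho_x$ for $f\colon x\to y$, with $\rho_{1_x}=1_{\rho_x}$, $\rho_{gf}=\rho_f\circ(\rho_g G(f))$, $\rho_f=\rho_g\circ(\rho_y G(\alpha))$ for each 2-cell $\alpha\colon f\to g\colon x\to y$, and $\rho_f$ invertible for $f\in M$; morphisms $\rho\to\rho'$ are families of 2-cells $m_x\colon\rho_x\to\rho'_x$ with $m_x\circ\rho_f=\rho'_f\circ(m_y G(f))$. A marked 2-functor $u\colon(\mathcal A,M_{\mathcal A})\to(\mathcal D,M)$ is final if for every 2-category $\mathcal E$, 2-functor $G\colon\mathcal D\to\mathcal E$ and object $d$ of $\mathcal E$, the restriction functor $\mathrm{Cocone}_M(G,d)\to\mathrm{Cocone}_{M_{\mathcal A}}(Gu,d)$ is an equivalence of categories. Here $\{c\}$ denotes the terminal 2-category with its identity marked, so $\mathrm{Cocone}(Gu,d)=\mathcal E(Gc,d)$ and restriction is evaluation at $c$.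 *)

(* Defs.v *)
From Stdlib Require Import Eqdep FunctionalExtensionality ProofIrrelevance.

Set Implicit Arguments.
Unset Strict Implicit.
Unset Printing Implicit Defensive.

Declare Scope cat_scope.
Delimit Scope cat_scope with cat.
Open Scope cat_scope.

Reserved Notation "g ∘ f" (at level 40, left associativity).
Reserved Notation "g • f" (at level 40, left associativity).
Reserved Notation "b ⋆ a" (at level 40, left associativity).
Reserved Notation "g ◁ a" (at level 40, left associativity).
Reserved Notation "b ▷ f" (at level 40, left associativity).
Reserved Notation "a ≡ b" (at level 70, no associativity).

(** * Categories *)

Record category := Category {
  obj :> Type;
  hom : obj -> obj -> Type;
  idm : forall a, hom a a;
  comp : forall a b c, hom b c -> hom a b -> hom a c;
  comp1m : forall a b (f : hom a b), comp (idm b) f = f;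
  compm1 : forall a b (f : hom a b), comp f (idm a) = f;
  compmA : forall a b c d (h : hom c d) (g : hom b c) (f : hom a b),
    comp h (comp g f) = comp (comp h g) f
}.
Arguments hom {c} _ _ : rename.
Arguments idm {c} _ : rename.
Arguments comp {c a b} {c0} _ _ : rename.

Notation "g ∘ f" := (comp g f) : cat_scope.

(* [f ≡ g]: the morphisms f and g are equal, together with their sources and
   their targets.  The strict laws below equate 2-cells whose boundaries are
   only provably equal, so they cannot be typed with [=]; between parallel
   morphisms [≡] is [=] (see [same_eq]). *)
Inductive same (A : category) (a b : A) (f : hom a b) :
    forall a' b' : A, hom a' b' -> Prop :=
  same_refl : same f f.
Notation "f ≡ g" := (same f g) : cat_scope.

Lemma same_eq (A : category) (a b : A) (f g : hom a b) : f ≡ g <-> f = g.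
Proof.
split; [intro H | intros ->; constructor].
assert (E : existT (fun p : A * A => hom (fst p) (snd p)) (a, b) f
          = existT (fun p : A * A => hom (fst p) (snd p)) (a, b) g)
  by (destruct H; reflexivity).
exact (inj_pair2 _ _ _ _ _ E).
Qed.

Lemma same_trans (A : category) (a b a' b' a'' b'' : A)
    (f : hom a b) (g : hom a' b') (h : hom a'' b'') : f ≡ g -> g ≡ h -> f ≡ h.
Proof. intros []; trivial. Qed.

Lemma same_idm (A : category) (a b : A) : a = b -> idm a ≡ idm b.
Proof. intros []; constructor. Qed.

Definition is_iso (A : category) (a b : A) (f : hom a b) : Prop :=
  exists g : hom b a, g ∘ f = idm a /\ f ∘ g = idm b.

Definition is_terminal (A : category) (t : A) : Prop :=
  forall a : A, exists f : hom a t, forall g : hom a t, g = f.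

Record functor (A B : category) := Functor {
  fobj :> A -> B;
  fmap : forall a b : A, hom a b -> hom (fobj a) (fobj b);
  fmap1 : forall a : A, fmap (idm a) = idm (fobj a);
  fmapM : forall (a b c : A) (g : hom b c) (f : hom a b),
    fmap (g ∘ f) = fmap g ∘ fmap f
}.
Arguments fmap {A B} _ {a b} _.

Lemma fmap_same (A B : category) (F : functor A B) (a b a' b' : A)
    (f : hom a b) (g : hom a' b') : f ≡ g -> fmap F f ≡ fmap F g.
Proof. intros []; constructor. Qed.

Definition idfunctor (A : category) : functor A A :=
  @Functor A A (fun a => a) (fun _ _ f => f)
    (fun _ => eq_refl) (fun _ _ _ _ _ => eq_refl).

Definition compfunctor (A B D : category) (G : functor B D) (F : functor A B) :
  functor A D.
Proof.
refine (@Functor A D (fun a => G (F a)) (fun a b f => fmap G (fmap F f)) _ _).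
- intros; rewrite !fmap1; reflexivity.
- intros; rewrite !fmapM; reflexivity.
Defined.

Definition preserves_terminal (A B : category) (F : functor A B) : Prop :=
  forall t : A, is_terminal t -> is_terminal (F t).

Record nat_iso (A B : category) (F G : functor A B) := NatIso {
  ncomp :> forall a : A, hom (F a) (G a);
  ncomp_iso : forall a, is_iso (ncomp a);
  ncomp_nat : forall (a b : A) (f : hom a b),
    ncomp b ∘ fmap F f = fmap G f ∘ ncomp a
}.

Definition is_equivalence (A B : category) (F : functor A B) : Prop :=
  exists G : functor B A,
    inhabited (nat_iso (compfunctor G F) (idfunctor A)) /\
    inhabited (nat_iso (compfunctor F G) (idfunctor B)).

(** * Strict 2-categories *)

(* The 1-cells x -> y are the objects of the hom-category [homcat x y], the
   2-cells its morphisms, and vertical composition [∘] its composition.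
   Horizontal composition is [•] on 1-cells and [⋆] on 2-cells; [hcomp_id]
   and [interchange] say that it is a functor
   [homcat y z × homcat x y -> homcat x z], and the remaining laws that it is
   strictly associative and unital. *)
Record two_category := TwoCategory {
  obj2 :> Type;
  homcat : obj2 -> obj2 -> category;
  id1 : forall x, homcat x x;
  comp1 : forall x y z, homcat y z -> homcat x y -> homcat x z;
  hcomp : forall x y z (g g' : homcat y z) (f f' : homcat x y),
    hom g g' -> hom f f' -> hom (comp1 g f) (comp1 g' f');
  hcomp_id : forall x y z (g : homcat y z) (f : homcat x y),
    hcomp (idm g) (idm f) = idm (comp1 g f);
  interchange : forall x y z (g g' g'' : homcat y z) (f f' f'' : homcat x y)
    (b : hom g g') (b' : hom g' g'') (a : hom f f') (a' : hom f' f''),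
    hcomp (b' ∘ b) (a' ∘ a) = hcomp b' a' ∘ hcomp b a;
  comp1_1f : forall x y (f : homcat x y), comp1 (id1 y) f = f;
  comp1_f1 : forall x y (f : homcat x y), comp1 f (id1 x) = f;
  comp1A : forall x y z w
    (h : homcat z w) (g : homcat y z) (f : homcat x y),
    comp1 h (comp1 g f) = comp1 (comp1 h g) f;
  hcomp_1a : forall x y (f f' : homcat x y) (a : hom f f'),
    hcomp (idm (id1 y)) a ≡ a;
  hcomp_a1 : forall x y (f f' : homcat x y) (a : hom f f'),
    hcomp a (idm (id1 x)) ≡ a;
  hcompA : forall x y z w (h h' : homcat z w) (g g' : homcat y z)
    (f f' : homcat x y) (d : hom h h') (b : hom g g') (a : hom f f'),
    hcomp d (hcomp b a) ≡ hcomp (hcomp d b) a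
}.
Arguments homcat {t} _ _ : rename.
Arguments id1 {t} x : rename.
Arguments comp1 {t x y z} _ _ : rename.
Arguments hcomp {t x y z g g' f f'} _ _ : rename.

Notation "g • f" := (comp1 g f) : cat_scope.
Notation "b ⋆ a" := (hcomp b a) : cat_scope.
(* Whiskerings, written gα and βf by juxtaposition in the literature. *)
Notation "g ◁ a" := (hcomp (idm g) a) : cat_scope.
Notation "b ▷ f" := (hcomp b (idm f)) : cat_scope.

Definition precomp (C : two_category) (a b c : C) (f : homcat a b) :
  functor (homcat b c) (homcat a c).
Proof.
refine (@Functor (homcat b c) (homcat a c)
  (fun g => g • f) (fun g g' t => t ▷ f) _ _).
- intros; apply hcomp_id.
- intros; rewrite <- interchange, comp1m; reflexivity.
Defined.

Record two_functor (C D : two_category) := TwoFunctor {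
  fobj2 :> C -> D;
  fhom : forall x y : C, functor (homcat x y) (homcat (fobj2 x) (fobj2 y));
  fhom_id1 : forall x : C, fhom x x (id1 x) = id1 (fobj2 x);
  fhom_comp1 : forall (x y z : C) (g : homcat y z) (f : homcat x y),
    fhom x z (g • f) = fhom y z g • fhom x y f;
  fhom_hcomp : forall (x y z : C) (g g' : homcat y z) (f f' : homcat x y)
    (b : hom g g') (a : hom f f'),
    fmap (fhom x z) (b ⋆ a) ≡ fmap (fhom y z) b ⋆ fmap (fhom x y) a
}.
Arguments fhom {C D} _ {x y}.

Definition comp_two_functor (A D E : two_category)
  (G : two_functor D E) (F : two_functor A D) : two_functor A E.
Proof.
refine (@TwoFunctor A E (fun x => G (F x))
  (fun x y => compfunctor (@fhom D E G (F x) (F y)) (@fhom A D F x y)) _ _ _).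
- intro x; simpl; rewrite !fhom_id1; reflexivity.
- intros x y z g f; simpl; rewrite !fhom_comp1; reflexivity.
- intros x y z g g' f f' b a; simpl.
  eapply same_trans; [apply fmap_same, fhom_hcomp | apply fhom_hcomp].
Defined.

(** * Marked 2-categories *)

Record marked_two_category := MarkedTwoCategory {
  underlying :> two_category;
  marked : forall x y : underlying, homcat x y -> Prop;
  marked_id1 : forall x : underlying, marked (id1 x)
}.
Arguments marked {m x y} _ : rename.

Record marked_two_functor (C D : marked_two_category) := MarkedTwoFunctor {
  underlying_functor :> two_functor C D;
  fhom_marked : forall (x y : C) (f : homcat x y),
    marked f -> marked (fhom underlying_functor f)
}.

Record M_final (C : marked_two_category) (c : C) : Prop := MFinal {
  M_final_terminal : forall a : C, exists t : homcat a c, is_terminal t;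
  M_final_id1 : is_terminal (id1 c);
  M_final_marked : forall a : C, exists f : homcat a c, marked f;
  M_final_precomp : forall (a b : C) (f : homcat a b),
    marked f -> preserves_terminal (precomp c f)
}.

(** * Contractions *)

Record contraction (C : two_category) (c : C) := Contraction {
  ctr1 :> forall x : C, homcat x c;
  ctr2 : forall (x y : C) (f : homcat x y), hom (ctr1 y • f) (ctr1 x);
  ctr2_id1 : forall x : C, ctr2 (id1 x) ≡ idm (ctr1 x);
  ctr2_comp1 : forall (x y z : C) (g : homcat y z) (f : homcat x y),
    ctr2 (g • f) ≡ ctr2 f ∘ (ctr2 g ▷ f);
  ctr2_nat : forall (x y : C) (f g : homcat x y) (a : hom f g),
    ctr2 f = ctr2 g ∘ (ctr1 y ◁ a);
  ctr1_center : ctr1 c = id1 c;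
  ctr2_ctr1 : forall x : C, ctr2 (ctr1 x) ≡ idm (ctr1 x)
}.
Arguments ctr2 {C c} _ {x y} f.

Definition is_M_contraction (C : marked_two_category) (c : C)
    (γ : contraction c) : Prop :=
  (forall x : C, marked (γ x)) /\
  (forall (x y : C) (f : homcat x y), marked f -> is_iso (ctr2 γ f)).

(** * Cocones and final 2-functors *)

Section Cocones.
Variables (D : marked_two_category) (E : two_category).
Variables (G : two_functor D E) (d : E).

Record cocone := Cocone {
  cc1 :> forall x : D, homcat (G x) d;
  cc2 : forall (x y : D) (f : homcat x y), hom (cc1 y • fhom G f) (cc1 x);
  cc2_id1 : forall x : D, cc2 (id1 x) ≡ idm (cc1 x);
  cc2_comp1 : forall (x y z : D) (g : homcat y z) (f : homcat x y),
    cc2 (g • f) ≡ cc2 f ∘ (cc2 g ▷ fhom G f);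
  cc2_nat : forall (x y : D) (f g : homcat x y) (a : hom f g),
    cc2 f = cc2 g ∘ (cc1 y ◁ fmap (fhom G) a);
  cc2_marked : forall (x y : D) (f : homcat x y), marked f -> is_iso (cc2 f)
}.
Arguments cc2 _ {x y} f.

Definition is_cocone_mor (r r' : cocone)
    (m : forall x : D, hom (r x) (r' x)) : Prop :=
  forall (x y : D) (f : homcat x y),
    m x ∘ cc2 r f = cc2 r' f ∘ (m y ▷ fhom G f).

Definition cocone_mor (r r' : cocone) : Type :=
  { m : forall x : D, hom (r x) (r' x) | is_cocone_mor m }.

Lemma cocone_mor_eq (r r' : cocone) (m n : cocone_mor r r') :
  (forall x, proj1_sig m x = proj1_sig n x) -> m = n.
Proof.
destruct m as [m Hm], n as [n Hn]; simpl; intro H.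
apply FunctionalExtensionality.functional_extensionality_dep in H.
subst n; f_equal; apply ProofIrrelevance.proof_irrelevance.
Qed.

Definition cocone_id (r : cocone) : cocone_mor r r.
Proof.
exists (fun x => idm (r x)); intros x y f.
rewrite hcomp_id, comp1m, compm1; reflexivity.
Defined.

Definition cocone_comp (r r' r'' : cocone)
  (n : cocone_mor r' r'') (m : cocone_mor r r') : cocone_mor r r''.
Proof.
exists (fun x => proj1_sig n x ∘ proj1_sig m x); intros x y f.
rewrite <- compmA, (proj2_sig m), compmA, (proj2_sig n), <- compmA.
rewrite <- interchange, comp1m; reflexivity.
Defined.

Definition cocone_cat : category.
Proof.
refine (@Category cocone cocone_mor cocone_id cocone_comp _ _ _);
  intros; apply cocone_mor_eq; intro; simpl.
- apply comp1m.
- apply compm1.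
- apply compmA.
Defined.

End Cocones.
Arguments cc2 {D E G d} _ {x y} f.

Section Restriction.
Variables (A D : marked_two_category) (u : marked_two_functor A D).
Variables (E : two_category) (G : two_functor D E) (d : E).

Lemma cc2_same (r : cocone G d) (x y : D) (f g : homcat x y) :
  f = g -> cc2 r f ≡ cc2 r g.
Proof. intros []; constructor. Qed.

Definition restrict_cocone (r : cocone G d) :
  @cocone A E (comp_two_functor G u) d.
Proof.
refine (@Cocone A E (comp_two_functor G u) d
  (fun x => r (u x)) (fun x y f => cc2 r (fhom u f)) _ _ _ _).
- intro x; simpl.
  eapply same_trans; [apply cc2_same, fhom_id1 | apply cc2_id1].
- intros x y z g f; simpl.
  eapply same_trans; [apply cc2_same, fhom_comp1 | apply cc2_comp1].
- intros x y f g a; simpl; apply cc2_nat.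
- intros x y f Hf; simpl; apply cc2_marked, fhom_marked, Hf.
Defined.

Definition restrict_cocone_mor (r r' : cocone G d) (m : cocone_mor r r') :
  cocone_mor (restrict_cocone r) (restrict_cocone r').
Proof.
exists (fun x => proj1_sig m (u x)); intros x y f; simpl.
apply (proj2_sig m).
Defined.

Definition restriction :
  functor (cocone_cat G d)
    (@cocone_cat A E (comp_two_functor G u) d).
Proof.
refine (@Functor (cocone_cat G d)
  (@cocone_cat A E (comp_two_functor G u) d)
  restrict_cocone restrict_cocone_mor _ _);
  intros; apply cocone_mor_eq; intro; reflexivity.
Defined.

End Restriction.

Definition is_final (A D : marked_two_category) (u : marked_two_functor A D) :
    Prop :=
  forall (E : two_category) (G : two_functor D E) (d : E),
    is_equivalence (restriction u G d).

(** * The inclusion of an object *)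

Definition unit_cat : category.
Proof.
refine (@Category unit (fun _ _ => unit) (fun _ => tt)
  (fun _ _ _ _ _ => tt) _ _ _); try reflexivity; intros ? ? []; reflexivity.
Defined.

Definition unit_two_cat : two_category.
Proof.
refine (@TwoCategory unit (fun _ _ => unit_cat) (fun _ => tt)
  (fun _ _ _ _ _ => tt) (fun _ _ _ _ _ _ _ _ _ => tt) _ _ _ _ _ _ _ _).
1, 2, 5: reflexivity.
1, 2: intros ? ? []; reflexivity.
1, 2: intros ? ? [] [] []; constructor.
intros; constructor.
Defined.

Definition unit_marked : marked_two_category :=
  @MarkedTwoCategory unit_two_cat
    (fun x y f => f = tt) (fun _ => eq_refl).

Definition inclusion_two_functor (C : two_category) (c : C) :
  two_functor unit_two_cat C.
Proof.
refine (@TwoFunctor unit_two_cat C (fun _ => c)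
  (fun _ _ => @Functor unit_cat (homcat c c)
     (fun _ => id1 c) (fun _ _ _ => idm (id1 c))
     (fun _ => eq_refl) (fun _ _ _ _ _ => eq_sym (comp1m _))) _ _ _).
- reflexivity.
- intros; simpl; rewrite comp1_1f; reflexivity.
- intros; simpl; rewrite hcomp_id; apply same_idm; rewrite comp1_1f.
  reflexivity.
Defined.

Definition inclusion (C : marked_two_category) (c : C) :
    marked_two_functor unit_marked C :=
  @MarkedTwoFunctor unit_marked C (inclusion_two_functor c)
    (fun _ _ _ _ => marked_id1 c).

(* Main.v *)
(** A cocone under [G] on a 2-category with an M-contraction [γ] is determined by
    its component at the centre: its component at [x] is, via the invertible
    2-cell at the marked 1-cell [γ x], isomorphic to [ρ_c G(γ x)], and conversely
    each [r : G c -> d] extends to the cocone [r G(γ x)].  So (ii) implies (iii).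
    If (iii) holds, essential surjectivity for [G = 1] and [d = c] yields a cocone
    [ρ] with [ρ_c ≅ 1].  A 2-cell [β : g -> f_a] satisfies
    [ρ_g = ρ_(f_a) ∘ (ρ_c β)], and whiskering with [ρ_c ≅ 1] is bijective on
    2-cells, so [f_a] is terminal; hence (i).  Given (i), every [f_a] is terminal
    and terminality supplies the 2-cells of the contraction and their laws. *)

Require Import Defs.
From Stdlib Require Import IndefiniteDescription.

Set Implicit Arguments.
Unset Strict Implicit.
Unset Printing Implicit Defensive.

(** * Equality of 2-cells with varying boundary *)

Lemma same_sym (A : category) (a b a' b' : A) (f : hom a b) (g : hom a' b') :
  f ≡ g -> g ≡ f.
Proof. intros []; constructor. Qed.

Lemma comp_same (A : category) (a b c a' b' c' : A)
    (g : hom b c) (f : hom a b) (g' : hom b' c') (f' : hom a' b') :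
  g ≡ g' -> f ≡ f' -> g ∘ f ≡ g' ∘ f'.
Proof.
intros Hg; destruct Hg; intros Hf.
(* The target [b] is now shared, so eliminating [Hf] yields the equality of sources; [same_eq] then
   turns the rest into a plain equality. *)
assert (E : a = a') by (destruct Hf; reflexivity); subst a'.
apply same_eq in Hf; subst f'; constructor.
Qed.

Lemma hcomp_same (C : two_category) (x y z : C)
    (g g' k k' : homcat y z) (f f' h h' : homcat x y)
    (b : hom g g') (b' : hom k k') (a : hom f f') (a' : hom h h') :
  b ≡ b' -> a ≡ a' -> b ⋆ a ≡ b' ⋆ a'.
Proof. intros [] []; constructor. Qed.

Lemma same_transport (A : category) (a b a' b' : A) (f : hom a b) :
  a = a' -> b = b' -> exists g : hom a' b', g ≡ f.
Proof. intros [] []; exists f; constructor. Qed.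

(** Only the source is transported: the 2-cells retyped this way below already have the right
    target. *)
Definition castdom (A : category) (a a' b : A) (e : a = a') (f : hom a b) :
  hom a' b := match e in _ = x return hom x b with eq_refl => f end.

Lemma castdom_same (A : category) (a a' b : A) (e : a = a') (f : hom a b) :
  castdom e f ≡ f.
Proof. destruct e; constructor. Qed.

(** * Isomorphisms and terminal objects *)

Lemma is_iso_idm (A : category) (a : A) : is_iso (idm a).
Proof. exists (idm a); split; apply comp1m. Qed.

Lemma is_iso_comp (A : category) (a b c : A) (g : hom b c) (f : hom a b) :
  is_iso g -> is_iso f -> is_iso (g ∘ f).
Proof.
intros [g' [Hg1 Hg2]] [f' [Hf1 Hf2]]; exists (f' ∘ g'); split.
- rewrite compmA, <- (compmA f' g' g), Hg1, compm1; exact Hf1.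
- rewrite compmA, <- (compmA g f f'), Hf2, compm1; exact Hg2.
Qed.

Lemma is_iso_fmap (A B : category) (F : functor A B) (a b : A) (f : hom a b) :
  is_iso f -> is_iso (fmap F f).
Proof.
intros [g [H1 H2]]; exists (fmap F g).
rewrite <- !fmapM, H1, H2, !fmap1; split; reflexivity.
Qed.

Lemma is_iso_same (A : category) (a b a' b' : A)
    (f : hom a b) (g : hom a' b') : f ≡ g -> is_iso f -> is_iso g.
Proof. intros []; trivial. Qed.

Lemma is_iso_hcomp (C : two_category) (x y z : C)
    (g g' : homcat y z) (f f' : homcat x y) (b : hom g g') (a : hom f f') :
  is_iso b -> is_iso a -> is_iso (b ⋆ a).
Proof.
intros [b' [Hb1 Hb2]] [a' [Ha1 Ha2]]; exists (b' ⋆ a').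
rewrite <- !interchange, Hb1, Hb2, Ha1, Ha2, !hcomp_id; split; reflexivity.
Qed.

Lemma is_iso_cancell (A : category) (a b c : A) (g : hom b c) (f f' : hom a b) :
  is_iso g -> g ∘ f = g ∘ f' -> f = f'.
Proof.
intros [g' [H _]] E.
rewrite <- (comp1m f), <- (comp1m f'), <- H, <- !compmA, E; reflexivity.
Qed.

Lemma is_iso_cancelr (A : category) (a b c : A) (f : hom a b) (g g' : hom b c) :
  is_iso f -> g ∘ f = g' ∘ f -> g = g'.
Proof.
intros [f' [_ H]] E.
rewrite <- (compm1 g), <- (compm1 g'), <- H, !compmA, E; reflexivity.
Qed.

Definition isomorphic (A : category) (a b : A) : Prop :=
  exists f : hom a b, is_iso f.

Lemma isomorphic_sym (A : category) (a b : A) :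
  isomorphic a b -> isomorphic b a.
Proof.
intros [f [g [H1 H2]]]; exists g, f; split; assumption.
Qed.

Lemma isomorphic_trans (A : category) (a b c : A) :
  isomorphic a b -> isomorphic b c -> isomorphic a c.
Proof.
intros [f Hf] [g Hg]; exists (g ∘ f); apply is_iso_comp; assumption.
Qed.

Lemma isomorphic_comp1 (C : two_category) (x y z : C)
    (g g' : homcat y z) (f : homcat x y) :
  isomorphic g g' -> isomorphic (g • f) (g' • f).
Proof.
intros [b Hb]; exists (b ▷ f).
apply is_iso_hcomp; [exact Hb | apply is_iso_idm].
Qed.

Lemma is_terminal_unique (A : category) (t a : A) (f g : hom a t) :
  is_terminal t -> f = g.
Proof.
intro Ht; destruct (Ht a) as [h Hh]; rewrite (Hh f), (Hh g); reflexivity.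
Qed.

(** Serves the contraction laws that equate 2-cells with a common terminal target and provably equal
    sources. *)
Lemma is_terminal_same (A : category) (t a a' : A)
    (f : hom a t) (g : hom a' t) :
  is_terminal t -> a = a' -> f ≡ g.
Proof.
intros Ht E; subst a'; apply same_eq, is_terminal_unique, Ht.
Qed.

Lemma is_terminal_is_iso (A : category) (s t : A) (f : hom s t) :
  is_terminal s -> is_terminal t -> is_iso f.
Proof.
intros Hs Ht; destruct (Hs t) as [g _]; exists g.
split; apply is_terminal_unique; assumption.
Qed.

Lemma is_terminal_isomorphic (A : category) (s t : A) :
  is_terminal s -> is_terminal t -> isomorphic s t.
Proof.
intros Hs Ht; destruct (Ht s) as [f _]; exists f.
apply is_terminal_is_iso; assumption.
Qed.

Lemma isomorphic_is_terminal (A : category) (s t : A) :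
  isomorphic s t -> is_terminal t -> is_terminal s.
Proof.
intros [f [g [H _]]] Ht a; destruct (Ht a) as [h _].
exists (g ∘ h); intro k.
rewrite <- (comp1m k), <- H, <- compmA; f_equal.
apply is_terminal_unique, Ht.
Qed.

(** * From M-final objects to M-contractions *)

Section FinalToContraction.
Variables (C : marked_two_category) (c : C) (f : forall a : C, homcat a c).
Hypothesis f_center : f c = id1 c.
Hypothesis f_terminal : forall a : C, is_terminal (f a).

(** Terminality only asserts existence, whereas the 2-cells of a contraction are data, hence the
    choice principle. *)
Definition to_f (a : C) (g : homcat a c) : hom g (f a) :=
  proj1_sig (constructive_indefinite_description _ (f_terminal g)).

(** Every law on 2-cells compares arrows into some terminal [f x], so only their sources have to be
    matched. *)
Definition terminal_contraction : contraction c.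
Proof.
refine (@Contraction C c f (fun x y g => to_f (f y • g)) _ _ _ f_center _).
- intro x; apply is_terminal_same; [apply f_terminal | apply comp1_f1].
- intros x y z g h; apply is_terminal_same; [apply f_terminal | apply comp1A].
- intros x y g h a; apply is_terminal_unique, f_terminal.
- intro x; apply is_terminal_same; [apply f_terminal |].
  rewrite f_center; apply comp1_1f.
Defined.

End FinalToContraction.

Lemma M_final_contraction (C : marked_two_category) (c : C)
    (f : forall a : C, homcat a c)
    (f_marked : forall a : C, marked (f a)) (f_center : f c = id1 c) :
  M_final c ->
  exists γ : contraction c, is_M_contraction γ /\ forall a : C, γ a = f a.
Proof.
intro H.
assert (Hf : forall a, is_terminal (f a)).
(* Precomposition with the marked [f a] sends the terminal [id1 c] to [f a]. *)
{ intro a; rewrite <- (comp1_1f (f a)).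
  exact (M_final_precomp H (f_marked a) (M_final_id1 H)). }
exists (terminal_contraction f_center Hf); split; [split |].
- exact f_marked.
(* For marked [g] the source [f y • g] is terminal too, and arrows between terminal objects are
   invertible. *)
- intros x y g Hg; apply is_terminal_is_iso; [| apply Hf].
  exact (M_final_precomp H Hg (Hf y)).
- reflexivity.
Qed.

(** * Cocones over a contracted 2-category *)

(** The pointwise inverses are compatible with the structure 2-cells: after composing with the
    invertible [m x], their square follows from that of [m]. *)
Lemma cocone_mor_is_iso (D : marked_two_category) (E : two_category)
    (G : two_functor D E) (d : E) (r r' : cocone_cat G d) (m : hom r r') :
  (forall x, is_iso (proj1_sig m x)) -> is_iso m.
Proof.
intro H.
pose (inv := fun x => constructive_indefinite_description _ (H x)).
assert (Hn : is_cocone_mor (r := r') (r' := r) (fun x => proj1_sig (inv x))).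
{ intros x y g; simpl.
  destruct (inv x) as [n [Hn1 Hn2]], (inv y) as [k [Hk1 Hk2]]; simpl.
  apply (is_iso_cancell (H x)).
  rewrite !compmA, Hn2, comp1m, (proj2_sig m), <- compmA, <- interchange.
  rewrite Hk2, comp1m, hcomp_id, compm1; reflexivity. }
exists (exist _ _ Hn : @hom (cocone_cat G d) r' r).
split; apply cocone_mor_eq; intro x; simpl; destruct (inv x) as [n [Hn1 Hn2]];
  assumption.
Qed.

(** Every 1-cell of the terminal 2-category is an identity, so such a cocone amounts to the single
    1-cell [r tt]. *)
Lemma unit_cocone_cc2 (E : two_category) (G : two_functor unit_marked E) (d : E)
    (r : cocone G d) (x y : unit_marked) (g : homcat x y) :
  cc2 r g ≡ idm (r x).
Proof. destruct x, y, g; exact (cc2_id1 r tt). Qed.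

Section ExtendCocone.
Variables (C : marked_two_category) (c : C) (γ : contraction c).
Hypothesis γ_marked : is_M_contraction γ.
Variables (E : two_category) (G : two_functor C E) (d : E).

Lemma extend_cc2_dom (r : homcat (G c) d) (x y : C) (g : homcat x y) :
  r • fhom G (γ y • g) = (r • fhom G (γ y)) • fhom G g.
Proof. rewrite fhom_comp1; apply comp1A. Qed.

(** The cast is there because [G] preserves composition, and [•] is associative, only up to a
    provable equality. *)
Definition extend_cc2 (r : homcat (G c) d) (x y : C) (g : homcat x y) :
  hom ((r • fhom G (γ y)) • fhom G g) (r • fhom G (γ x)) :=
  castdom (extend_cc2_dom r g) (r ◁ fmap (fhom G) (ctr2 γ g)).

Lemma extend_cc2E (r : homcat (G c) d) (x y : C) (g : homcat x y) :
  extend_cc2 r g ≡ r ◁ fmap (fhom G) (ctr2 γ g).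
Proof. apply castdom_same. Qed.

Lemma whisker_fmap_comp (r : homcat (G c) d) (x : C)
    (f g h : homcat x c) (b : hom g h) (a : hom f g) :
  r ◁ fmap (fhom G) (b ∘ a) =
  (r ◁ fmap (fhom G) b) ∘ (r ◁ fmap (fhom G) a).
Proof. rewrite fmapM, <- interchange, comp1m; reflexivity. Qed.

(** Each cocone law is the corresponding law of [γ], mapped by [G] and whiskered with [r]. *)
Definition extend_cocone (r : homcat (G c) d) : cocone G d.
Proof.
refine (@Cocone C E G d (fun x => r • fhom G (γ x))
  (fun x y g => extend_cc2 r g) _ _ _ _).
- intro x; eapply same_trans; [apply extend_cc2E |].
  rewrite <- hcomp_id, <- fmap1.
  apply hcomp_same; [constructor | apply fmap_same, ctr2_id1].
- intros x y z g f; eapply same_trans; [apply extend_cc2E |].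
  eapply same_trans.
  { apply hcomp_same; [apply same_refl | apply fmap_same, ctr2_comp1]. }
  rewrite whisker_fmap_comp.
  apply comp_same; [apply same_sym, extend_cc2E |].
  eapply same_trans.
  { apply hcomp_same; [apply same_refl | apply fhom_hcomp]. }
  rewrite fmap1; eapply same_trans; [apply hcompA |].
  apply hcomp_same; [apply same_sym, extend_cc2E | constructor].
- intros x y f g a; apply same_eq.
  eapply same_trans; [apply extend_cc2E |].
  rewrite (ctr2_nat γ a), whisker_fmap_comp.
  apply comp_same; [apply same_sym, extend_cc2E |].
  eapply same_trans.
  { apply hcomp_same; [apply same_refl | apply fhom_hcomp]. }
  rewrite fmap1, <- hcomp_id; apply hcompA.
- intros x y f Hf.
  refine (is_iso_same (same_sym (extend_cc2E r f)) _).
  apply is_iso_hcomp; [apply is_iso_idm | apply is_iso_fmap].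
  exact (proj2 γ_marked x y f Hf).
Defined.

Definition extend_cocone_mor (r r' : homcat (G c) d) (m : hom r r') :
  cocone_mor (extend_cocone r) (extend_cocone r').
Proof.
exists (fun x => m ▷ fhom G (γ x)); intros x y f; simpl; apply same_eq.
eapply same_trans.
{ apply comp_same; [apply same_refl | apply extend_cc2E]. }
(* By interchange, both sides of the square are [m ⋆ fmap (fhom G) (ctr2 γ f)] up to [≡]. *)
rewrite <- interchange, compm1, comp1m.
apply same_sym; eapply same_trans.
{ apply comp_same; [apply extend_cc2E |].
  eapply same_trans; [apply same_sym, hcompA |].
  rewrite hcomp_id.
  apply hcomp_same; [apply same_refl |].
  apply same_idm, eq_sym, fhom_comp1. }
rewrite <- interchange, compm1, comp1m; constructor.
Defined.

Definition extension :
  functor (@cocone_cat unit_marked E (comp_two_functor G (inclusion c)) d)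
    (cocone_cat G d).
Proof.
refine (@Functor (@cocone_cat unit_marked E (comp_two_functor G (inclusion c)) d)
  (cocone_cat G d)
  (fun r => extend_cocone (r tt))
  (fun r r' m => extend_cocone_mor (proj1_sig m tt)) _ _);
  intros; apply cocone_mor_eq; intro; simpl.
- apply hcomp_id.
- rewrite <- interchange, comp1m; reflexivity.
Defined.

Definition extension_counit_mor (ρ : cocone G d) :
  cocone_mor (extend_cocone (ρ c)) ρ.
Proof.
exists (fun x => cc2 ρ (γ x)); intros x y g; simpl; apply same_eq.
eapply same_trans.
{ apply comp_same; [apply same_refl | apply extend_cc2E]. }
(* Naturality of [ρ] at the 2-cell [ctr2 γ g] and the composition law both compute
   [cc2 ρ (γ y • g)]. *)
rewrite <- (cc2_nat ρ (ctr2 γ g)); apply cc2_comp1.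
Defined.

Definition extension_counit :
  nat_iso (compfunctor extension (restriction (inclusion c) G d))
    (idfunctor (cocone_cat G d)).
Proof.
refine (@NatIso _ _ (compfunctor extension (restriction (inclusion c) G d))
  (idfunctor (cocone_cat G d)) extension_counit_mor _ _).
- intro ρ; apply cocone_mor_is_iso; intro x; simpl.
  apply cc2_marked, (proj1 γ_marked).
(* Naturality in [ρ] is the compatibility of [m] with the 1-cell [γ x]. *)
- intros ρ ρ' m; apply cocone_mor_eq; intro x; simpl.
  symmetry; apply (proj2_sig m).
Defined.

Lemma extension_at_center (r : homcat (G c) d) : r = r • fhom G (γ c).
Proof. rewrite ctr1_center, fhom_id1, comp1_f1; reflexivity. Qed.

(** As [γ c] equals [id1 c], extending and then restricting returns the same 1-cell up to a provable
    equality; the component is a retyped identity, and the match lets [r x] reduce to [r tt]. *)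
Definition extension_unit_mor
    (r : @cocone unit_marked E (comp_two_functor G (inclusion c)) d) :
  cocone_mor (restrict_cocone (inclusion c) (extend_cocone (r tt))) r.
Proof.
exists (fun x => match x return hom (r tt • fhom G (γ c)) (r x) with
                 | tt => castdom (extension_at_center (r tt)) (idm (r tt))
                 end).
intros [] [] g; apply same_eq.
eapply same_trans; [eapply comp_same; [apply same_refl | apply unit_cocone_cc2] |].
rewrite compm1.
apply same_sym; eapply same_trans.
{ eapply comp_same; [apply unit_cocone_cc2 |].
  eapply same_trans.
  { apply hcomp_same; [apply same_refl |].
    apply same_idm; exact (fhom_id1 G c). }
  eapply same_trans; [apply hcomp_a1 | apply castdom_same]. }
rewrite comp1m; apply same_sym, castdom_same.
Defined.

Definition extension_unit :
  nat_iso (compfunctor (restriction (inclusion c) G d) extension)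
    (idfunctor (@cocone_cat unit_marked E (comp_two_functor G (inclusion c)) d)).
Proof.
refine (@NatIso _ _ (compfunctor (restriction (inclusion c) G d) extension)
  (idfunctor (@cocone_cat unit_marked E (comp_two_functor G (inclusion c)) d))
  extension_unit_mor _ _).
- intro r; apply cocone_mor_is_iso; intros []; simpl.
  eapply is_iso_same; [apply same_sym, castdom_same | apply is_iso_idm].
- intros r r' m; apply cocone_mor_eq; intros []; simpl; apply same_eq.
  eapply same_trans.
  { eapply comp_same; [apply castdom_same |].
    eapply same_trans.
    { apply hcomp_same; [apply same_refl |].
      apply same_idm; rewrite ctr1_center; apply fhom_id1. }
    apply hcomp_a1. }
  rewrite comp1m; apply same_sym; eapply same_trans.
  { eapply comp_same; [apply same_refl | apply castdom_same]. }
  rewrite compm1; constructor.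
Defined.

End ExtendCocone.

Lemma M_contraction_is_final (C : marked_two_category) (c : C)
    (γ : contraction c) :
  is_M_contraction γ -> is_final (inclusion c).
Proof.
intros H E G d; exists (extension H G d); split; constructor.
- apply extension_counit.
- apply extension_unit.
Qed.

(** * Finality of the inclusion implies M-finality *)

Definition id_two_functor (C : two_category) : two_functor C C.
Proof.
refine (@TwoFunctor C C (fun x => x) (fun x y => idfunctor (homcat x y)) _ _ _).
- reflexivity.
- reflexivity.
- intros; constructor.
Defined.

Definition unit_cocone_id1 (C : two_category) (c : C) :
  @cocone unit_marked C
    (comp_two_functor (id_two_functor C) (inclusion_two_functor c)) c.
Proof.
refine (@Cocone unit_marked C
  (comp_two_functor (id_two_functor C) (inclusion_two_functor c)) c
  (fun _ => id1 c)
  (fun _ _ _ => castdom (eq_sym (comp1_1f (id1 c))) (idm (id1 c))) _ _ _ _).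
- intro x; apply castdom_same.
- intros x y z g f; simpl.
  set (i := castdom _ _); assert (Hi : i ≡ idm (id1 c)) by apply castdom_same.
  apply same_sym; eapply same_trans.
  { eapply comp_same; [exact Hi |].
    eapply same_trans; [apply hcomp_a1 | exact Hi]. }
  rewrite comp1m; apply same_sym, Hi.
- intros; simpl; rewrite hcomp_id, compm1; reflexivity.
- intros; simpl.
  eapply is_iso_same; [apply same_sym, castdom_same | apply is_iso_idm].
Defined.

Lemma final_inclusion_cocone (C : marked_two_category) (c : C) :
  is_final (inclusion c) ->
  exists ρ : @cocone C C (id_two_functor C) c, isomorphic (id1 c) (ρ c).
Proof.
intro H; destruct (H C (id_two_functor C) c) as [K [_ [ε]]].
exists (K (unit_cocone_id1 c)); apply isomorphic_sym.
destruct (ncomp_iso ε (unit_cocone_id1 c)) as [n [H1 H2]].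
exists (proj1_sig (ncomp ε (unit_cocone_id1 c)) tt), (proj1_sig n tt).
split; [exact (f_equal (fun m => proj1_sig m tt) H1)
       |exact (f_equal (fun m => proj1_sig m tt) H2)].
Qed.

(** * Whiskering with a 1-cell isomorphic to an identity *)

Lemma whisker_id1_inj (C : two_category) (x y : C) (g g' : homcat x y)
    (a b : hom g g') : id1 y ◁ a = id1 y ◁ b -> a = b.
Proof.
intro H; apply same_eq.
eapply same_trans; [apply same_sym, hcomp_1a |].
rewrite H; apply hcomp_1a.
Qed.

Lemma whisker_id1_surj (C : two_category) (x y : C) (g g' : homcat x y)
    (h : hom (id1 y • g) (id1 y • g')) : exists a : hom g g', id1 y ◁ a = h.
Proof.
destruct (same_transport h (comp1_1f g) (comp1_1f g')) as [a Ha].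
exists a; apply same_eq; eapply same_trans; [apply hcomp_1a | exact Ha].
Qed.

(** Both sides are [φ ⋆ a] by interchange. *)
Lemma whisker_exchange (C : two_category) (x y z : C) (p q : homcat y z)
    (g g' : homcat x y) (φ : hom p q) (a : hom g g') :
  (q ◁ a) ∘ (φ ▷ g) = (φ ▷ g') ∘ (p ◁ a).
Proof. rewrite <- !interchange, !compm1, !comp1m; reflexivity. Qed.

Section WhiskerIso.
Variables (C : two_category) (x y : C) (p : homcat y y).
Hypothesis Hp : isomorphic (id1 y) p.
Variables (g g' : homcat x y).

(** Conjugation with the invertible whiskerings of [φ] turns [p ◁ a] into [id1 y ◁ a], which
    determines [a] by strict unitality. *)
Lemma whisker_inj (a b : hom g g') : p ◁ a = p ◁ b -> a = b.
Proof.
destruct Hp as [φ Hφ]; intro H; apply whisker_id1_inj.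
apply (is_iso_cancell (is_iso_hcomp Hφ (is_iso_idm g'))).
rewrite <- !whisker_exchange, H; reflexivity.
Qed.

Lemma whisker_surj (h : hom (p • g) (p • g')) : exists a : hom g g', p ◁ a = h.
Proof.
destruct Hp as [φ Hφ].
destruct (is_iso_hcomp Hφ (is_iso_idm g')) as [ψ [_ Hψ]].
(* The preimage is [h] conjugated by [φ] into a 2-cell from [id1 y • g] to [id1 y • g']. *)
destruct (whisker_id1_surj (ψ ∘ (h ∘ (φ ▷ g)))) as [a Ha].
exists a.
apply (is_iso_cancelr (is_iso_hcomp Hφ (is_iso_idm g))).
rewrite whisker_exchange, Ha, compmA, Hψ, comp1m; reflexivity.
Qed.

End WhiskerIso.

Lemma final_inclusion_M_final (C : marked_two_category) (c : C)
    (f : forall a : C, homcat a c)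
    (f_marked : forall a : C, marked (f a)) (f_center : f c = id1 c) :
  is_final (inclusion c) -> M_final c.
Proof.
intro H; destruct (final_inclusion_cocone H) as [ρ Hρ].
assert (f_terminal : forall a, is_terminal (f a)).
{ intros a g.
  pose proof (cc2_marked ρ (f_marked a)) as Hiso.
  pose proof Hiso as [k [Hk1 Hk2]].
  (* Since [k] inverts [cc2 ρ (f a)], this [α] solves the equation that naturality of [ρ] imposes on
     every 2-cell from [g] to [f a]. *)
  destruct (whisker_surj Hρ (k ∘ cc2 ρ g)) as [α Hα].
  exists α; intro β; apply (whisker_inj Hρ).
  refine (eq_trans _ (eq_sym Hα)).
  apply (is_iso_cancell Hiso).
  rewrite compmA, Hk2, comp1m; symmetry; exact (cc2_nat ρ β). }
assert (fρ : forall a, isomorphic (f a) (ρ a)).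
{ intro a; apply isomorphic_trans with (ρ c • f a).
  - rewrite <- (comp1_1f (f a)) at 1; apply isomorphic_comp1, Hρ.
  - exists (cc2 ρ (f a)); apply (cc2_marked ρ), f_marked. }
constructor.
- intro a; exists (f a); apply f_terminal.
- rewrite <- f_center; apply f_terminal.
- intro a; exists (f a); apply f_marked.
(* The chain of isomorphisms is [t • g], [f b • g], [ρ b • g], [ρ a], [f a]; the third one is
   [cc2 ρ g], invertible as [g] is marked. *)
- intros a b g Hg t Ht; apply isomorphic_is_terminal with (f a);
    [| apply f_terminal].
  apply isomorphic_trans with (ρ b • g).
  + apply isomorphic_comp1, isomorphic_trans with (f b); [| apply fρ].
    apply is_terminal_isomorphic; [exact Ht | apply f_terminal].
  + apply isomorphic_trans with (ρ a); [| apply isomorphic_sym, fρ].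
    exists (cc2 ρ g); exact (cc2_marked ρ Hg).
Qed.

Theorem proposition2p2p11 (C : marked_two_category) (c : C)
    (f : forall a : C, homcat a c)
    (f_marked : forall a : C, marked (f a)) (f_center : f c = id1 c) :
  (M_final c <->
     exists γ : contraction c, is_M_contraction γ /\ forall a : C, γ a = f a) /\
  ((exists γ : contraction c, is_M_contraction γ /\ forall a : C, γ a = f a) <->
     is_final (inclusion c)).
Proof.
assert (i_ii := M_final_contraction f_marked f_center).
assert (iii_i := final_inclusion_M_final f_marked f_center).
assert (ii_iii : (exists γ : contraction c,
    is_M_contraction γ /\ forall a : C, γ a = f a) -> is_final (inclusion c))
  by (intros [γ [H _]]; exact (M_contraction_is_final H)).
tauto.
Qed.
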